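(* Suppose that $S$ is finite or countably infinite. Let $\emptyset\ne C\subseteq S$, let $\alpha:S\to[0,\infty)$, and let $r:S\to[0,\infty)$ satisfy $r(x)\le 1$ for all $x\in S$. For $1\le n\le\infty$, let $P_n=(P_n(x,y):x,y\in S)$ be a transition matrix with a unique stationary distribution $\pi_n$, and assume that $P_\infty$ is irreducible. If, for each $x,y\in S$, (i) $P_n(x,y)\to P_\infty(x,y)$ as $n\to\infty$; (ii) $\pi_n(x)\to\pi_\infty(x)$ as $n\to\infty$, then, for each $x\in S$, $u_n^*(x)\to u_\infty^*(x)$ as $n\to\infty$, where $$u_n^*(x)=\mathbb{E}_{n,x}\left[\sum_{j=0}^{T}\exp\left(-\sum_{k=0}^{j-1}\alpha(X_k)\right)r(X_j)\right],\qquad T=\inf\{j\ge 0:X_j\in C^c\}.$$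
   Context: The index $n$ ranges over $\{1,2,\dots\}\cup\{\infty\}$. $\mathbb{E}_{n,x}$ is expectation under the law $P_{n,x}$ for which $X=(X_m:m\ge 0)$ is a Markov chain on $S$ with $X_0=x$ and transition matrix $P_n$. A stationary distribution is a probability vector $\pi_n$ with $\sum_{x}\pi_n(x)P_n(x,y)=\pi_n(y)$ for all $y\in S$. $C^c=S\setminus C$ may be empty, in which case $T=\infty$; when $T=\infty$ the sum over $j$ runs over all $j\ge 0$; an empty sum is $0$. The quantities $u_n^*(x)$ take values in $[0,\infty]$, and convergence is in $[0,\infty]$ (so if $u_\infty^*(x)=\infty$ the conclusion is $u_n^*(x)\to\infty$). *)

(* Defs.v *)
(* MathComp-Analysis. *)
From HB Require Import structures.
From mathcomp Require Export all_boot all_order all_algebra.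
From mathcomp Require Export all_classical all_reals all_analysis.

Set Implicit Arguments.
Unset Strict Implicit.
Unset Printing Implicit Defensive.
Import Order.TTheory GRing.Theory Num.Theory.
Import numFieldNormedType.Exports.
Local Open Scope classical_set_scope.
Local Open Scope ring_scope.
Local Open Scope ereal_scope.

Section matrices.
Variables (R : realType) (S : countType).
Implicit Types (P : S -> S -> R) (pi : S -> R).

Definition probability_vector pi : Prop :=
  (forall x, (0 <= pi x)%R) /\ \esum_(x in [set: S]) (pi x)%:E = 1.

Definition transition_matrix P : Prop := forall x, probability_vector (P x).

Definition stationary_distribution P pi : Prop :=
  probability_vector pi /\
  forall y, \esum_(x in [set: S]) (pi x * P x y)%:E = (pi y)%:E.

Definition unique_stationary_distribution P pi : Prop :=
  stationary_distribution P pi /\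
  forall mu, stationary_distribution P mu -> mu = pi.

Fixpoint matrix_power P (m : nat) (x y : S) : \bar R :=
  if m is m'.+1 then \esum_(z in [set: S]) ((P x z)%:E * matrix_power P m' z y)
  else (x == y)%:R%:E.

Definition irreducible P : Prop :=
  forall x y, exists m : nat, 0 < matrix_power P m x y.

End matrices.

Section chain.
Variables (R : realType) (S : countType).
Variables (d : measure_display) (Omega : measurableType d).
Implicit Types (X : nat -> Omega -> S) (Pr : probability Omega R).

Definition path_event X (m : nat) (s : nat -> S) : set Omega :=
  [set w | forall i, (i <= m)%N -> X i w = s i].

(* [S] carries the discrete sigma-algebra; as it is countable, measurability
   of [X m] only has to be required for preimages of points.  The last clause is
     Pr(X_(m+1) = s_(m+1) | X_0 = s_0, ..., X_m = s_m) = P(s_m, s_(m+1)). *)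
Definition markov_chain Pr X (x : S) (P : S -> S -> R) : Prop :=
  [/\ forall m y, measurable (X m @^-1` [set y]),
      Pr (X 0%N @^-1` [set x]) = 1
    & forall (m : nat) (s : nat -> S), 0 < Pr (path_event X m s) ->
        (fine (Pr (X m.+1 @^-1` [set s m.+1] `&` path_event X m s)) /
           fine (Pr (path_event X m s)))%R = P (s m) (s m.+1)].

(* [+oo] when the path never leaves [C], the infimum of the empty set. *)
Definition exit_time X (C : set S) (w : Omega) : \bar R :=
  ereal_inf [set j%:R%:E | j in [set j : nat | (~` C) (X j w)]].

Definition discounted_reward X (C : set S) (alpha r : S -> R) (w : Omega)
    : \bar R :=
  \sum_(0 <= j <oo | (j%:R%:E <= exit_time X C w)%E)
    (expR (- \sum_(0 <= k < j) alpha (X k w)) * r (X j w))%:E.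

(* Taking values in [0, +oo], hence an extended-real integral and not the
   library's expectation, which is for real-valued random variables. *)
Definition expected_reward Pr X (C : set S) (alpha r : S -> R) : \bar R :=
  \int[Pr]_w discounted_reward X C alpha r w.

End chain.

(* Main.v *)
(* Killing the chain at rate 1 - k, with k = exp(-alpha) on C and k = 0 off C,
   turns the expected reward into the series of the (diag(k) P)^j r. Each term
   is continuous in P by Scheffe's argument, so only the uniform smallness of
   the tails is at stake. If k(z) < 1 for some z, let q = max(k, 1/2) and
   f_j = (diag(q) P)^j 1; stationarity gives
     pi f_{j+1} + pi(z) (1 - q(z)) f_{j+1}(z) <= pi f_j,
   and telescoping bounds the tail at z of the n-th chain by pi_n f_J, which
   converges to pi_oo f_J, itself small for large J. Since q > 0, the bound
   propagates from z along the edges of the irreducible limit chain. If k = 1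
   everywhere, a finite limit forces P^j r -> 0, whence pi r = 0 and r = 0; an
   infinite limit only needs lower semicontinuity. *)
Require Import Defs.
From mathcomp Require Import measurable_realfun ring lra.
Set Implicit Arguments.
Unset Strict Implicit.
Unset Printing Implicit Defensive.
Import Order.TTheory GRing.Theory Num.Theory.
Import numFieldNormedType.Exports.
Local Open Scope classical_set_scope.
Local Open Scope ring_scope.

(** * Unordered sums: scaling, interchange and lower semicontinuity *)

Lemma esumZl (R : realType) (T : choiceType) (c : R) (a : T -> \bar R) :
  0 <= c -> (forall t, 0 <= a t)%E ->
  \esum_(t in [set: T]) (c%:E * a t)%E = (c%:E * \esum_(t in [set: T]) a t)%E.
Proof.
move=> c0 a0; rewrite /esum -ereal_supZl//; last first.
  apply/set0P; exists 0%E, set0; first exact: fsets_set0.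
  by rewrite fsbig_set0.
congr ereal_sup; apply/seteqP; split => [_ [A fA <-]|_ [_ [A fA <-] <-]] /=.
  exists (\sum_(t \in A) a t); first by exists A.
  by rewrite ge0_mule_fsumr.
by exists A => //; rewrite ge0_mule_fsumr.
Qed.

Lemma esum_ge1 (R : realType) (T : choiceType) (a : T -> \bar R) (t : T) :
  (forall t, 0 <= a t)%E -> (a t <= \esum_(t in [set: T]) a t)%E.
Proof.
move=> a0; apply: esum_ge; exists [set t]; last by rewrite fsbig_set1.
by split => //; exact: finite_set1.
Qed.

Lemma esum_single (R : realType) (T : choiceType) (a : T -> \bar R) (t : T) :
  (0 <= a t)%E -> (forall s, s != t -> a s = 0)%E ->
  \esum_(s in [set: T]) a s = a t.
Proof.
move=> a0 aN; rewrite -[RHS]esum_set1// [RHS]esum_mkcond; apply: eq_esum => s _.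
by case: ifPn => //; rewrite notin_setE => /eqP /aN.
Qed.

Lemma esum_interchange (R : realType) (T T' : choiceType)
    (a : T -> T' -> \bar R) : (forall t t', 0 <= a t t')%E ->
  \esum_(t in [set: T]) \esum_(t' in [set: T']) a t t' =
  \esum_(t' in [set: T']) \esum_(t in [set: T]) a t t'.
Proof.
move=> a0; rewrite !esum_esum//.
rewrite (reindex_esum ([set: T'] `*`` fun=> [set: T]) _
  (fun x => (x.2, x.1)))//.
split => //= [[t1 t1'] [t2 t2'] _ _ [-> ->]//|[t t'] _].
by exists (t', t).
Qed.

(** Fatou's inequality for sums: the sum is a supremum over finite index sets, so some finite
    partial sum already exceeds [c], and finite sums pass to the limit. *)
Lemma lt_esum_near (R : realType) (T : choiceType) (a_ : nat -> T -> R)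
    (a : T -> R) (c : \bar R) :
  (forall t, a_ n t @[n --> \oo] --> a t) ->
  (c < \esum_(t in [set: T]) (a t)%:E)%E ->
  \forall n \near \oo, (c < \esum_(t in [set: T]) (a_ n t)%:E)%E.
Proof.
move=> a_cvg /ereal_sup_gt[_ [A [finA _] <-]].
rewrite fsumEFin// fsbig_finite//= => cA.
have h : \sum_(t <- finmap.enum_fset (fset_set A)) a_ n t @[n --> \oo]
    --> \sum_(t <- finmap.enum_fset (fset_set A)) a t.
  by apply: cvg_big => [|t _]; [exact: add_continuous|exact: a_cvg].
have {}h : (\sum_(t <- finmap.enum_fset (fset_set A)) a_ n t)%:E @[n --> \oo]
    --> (\sum_(t <- finmap.enum_fset (fset_set A)) a t)%:E.
  by apply: cvg_EFin => //; exact: nearW.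
have : \forall n \near \oo,
    (c < (\sum_(t <- finmap.enum_fset (fset_set A)) a_ n t)%:E)%E.
  apply: (h [set y | (c < y)%E]); apply: open_nbhs_nbhs; split => //.
  exact: open_ereal_gt_ereal.
apply: filterS => n /lt_le_trans; apply; apply: esum_ge; exists A => //.
by rewrite fsumEFin// fsbig_finite.
Qed.

(** * Averages of [0,1]-valued functions against probability vectors *)

Section expectation.
Variables (R : realType) (S : countType).
Implicit Types (p : S -> R) (f g : S -> R).

Definition unit_valued f := forall x, 0 <= f x <= 1.

(** Real-valued, for use in real limits and linear arithmetic. [fine] loses nothing when [p] is a
    probability vector and [f] is [0,1]-valued, since the sum is then at most 1. *)
Definition expect p f : R := fine (\esum_(x in [set: S]) (p x * f x)%:E).

Lemma esum_le1 p f : probability_vector p -> unit_valued f ->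
  (\esum_(x in [set: S]) (p x * f x)%:E <= 1)%E.
Proof.
move=> [p0 <-] f01; apply: le_esum => x _; rewrite lee_fin.
by have /andP[_ ?] := f01 x; rewrite ler_piMr.
Qed.

Lemma esum_term_ge0 p f x : probability_vector p -> unit_valued f ->
  (0 <= (p x * f x)%:E)%E.
Proof.
by move=> [p0 _] f01; have /andP[? _] := f01 x; rewrite lee_fin mulr_ge0.
Qed.

Lemma expectE p f : probability_vector p -> unit_valued f ->
  (expect p f)%:E = \esum_(x in [set: S]) (p x * f x)%:E.
Proof.
move=> pp f01; rewrite fineK// ge0_fin_numE ?esum_ge0//.
- by rewrite (le_lt_trans (esum_le1 pp f01))// ltry.
- by move=> x _; exact: esum_term_ge0.
Qed.

Lemma expect_unit p f : probability_vector p -> unit_valued f ->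
  0 <= expect p f <= 1.
Proof.
move=> pp f01; rewrite -!lee_fin expectE// esum_le1// andbT esum_ge0// => x _.
exact: esum_term_ge0.
Qed.

Lemma expect_ge p f x : probability_vector p -> unit_valued f ->
  p x * f x <= expect p f.
Proof.
move=> pp f01; rewrite -lee_fin expectE//.
apply: (@esum_ge1 R S (fun x => (p x * f x)%:E)) => y.
exact: esum_term_ge0.
Qed.

Lemma le_expect p f g : probability_vector p ->
  unit_valued f -> unit_valued g -> (forall x, f x <= g x) ->
  expect p f <= expect p g.
Proof.
move=> pp f01 g01 fg; rewrite -lee_fin !expectE//; apply: le_esum => x _.
by case: pp => p0 _; rewrite lee_fin ler_wpM2l.
Qed.

Lemma expectD p f g : probability_vector p ->
  unit_valued f -> unit_valued g -> unit_valued (fun x => f x + g x) ->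
  expect p (fun x => f x + g x) = expect p f + expect p g.
Proof.
move=> pp f01 g01 fg01; apply: EFin_inj; rewrite EFinD !expectE//.
rewrite -esumD; [|by move=> x _; exact: esum_term_ge0..].
by apply: eq_esum => x _; rewrite mulrDr.
Qed.

Lemma expect_point p (z : S) (c : R) : probability_vector p -> 0 <= c <= 1 ->
  expect p (fun x => if x == z then c else 0) = p z * c.
Proof.
move=> pp c01; apply: EFin_inj; rewrite expectE//; last first.
  by move=> x; case: ifP => // _; rewrite lexx ler01.
have /andP[c0 _] := c01; have [p0 _] := pp.
rewrite (@esum_single R S _ z) ?eqxx//=; first by rewrite lee_fin mulr_ge0.
by move=> s /negbTE ->; rewrite mulr0.
Qed.

Lemma expect1 p : probability_vector p -> expect p (fun=> 1) = 1.
Proof.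
move=> pp; apply: EFin_inj; rewrite expectE//; last first.
  by move=> x; rewrite ler01 lexx.
by case: pp => _ <-; apply: eq_esum => x _; rewrite mulr1.
Qed.

Lemma unit_valued_onem f : unit_valued f -> unit_valued (fun x => 1 - f x).
Proof. by move=> f01 x; have := f01 x; lra. Qed.

Lemma expect_onem p f : probability_vector p -> unit_valued f ->
  expect p (fun x => 1 - f x) = 1 - expect p f.
Proof.
move=> pp f01; apply/eqP; rewrite eq_sym subr_eq -expectD//; last 2 first.
- exact: unit_valued_onem.
- by move=> x; rewrite subrK ler01 lexx.
rewrite -[eqbLHS](expect1 pp); apply/eqP; congr expect.
by apply/funext => x; rewrite subrK.
Qed.

(* Scheffe's argument: lower semicontinuity for both f and 1 - f. *)
Lemma cvg_expect (p_ : nat -> S -> R) p (f_ : nat -> S -> R) f :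
  (forall n, probability_vector (p_ n)) -> probability_vector p ->
  (forall n, unit_valued (f_ n)) -> unit_valued f ->
  (forall x, p_ n x @[n --> \oo] --> p x) ->
  (forall x, f_ n x @[n --> \oo] --> f x) ->
  expect (p_ n) (f_ n) @[n --> \oo] --> expect p f.
Proof.
move=> pp_ pp f_01 f01 p_cvg f_cvg.
have lower (g_ : nat -> S -> R) g e : (forall n, unit_valued (g_ n)) ->
    unit_valued g -> (forall x, g_ n x @[n --> \oo] --> g x) -> 0 < e ->
    \forall n \near \oo, expect p g - e < expect (p_ n) (g_ n).
  move=> g_01 g01 g_cvg e0.
  have : \forall n \near \oo, ((expect p g - e)%:E <
      \esum_(x in [set: S]) (p_ n x * g_ n x)%:E)%E.
    apply: (@lt_esum_near R S _ (fun x => p x * g x)) => [x|].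
      by apply: cvgM; [exact: p_cvg|exact: g_cvg].
    by rewrite -expectE// lte_fin ltrBlDr ltrDl.
  by apply: filterS => n; rewrite -expectE.
apply/cvgrPdist_le => e e0.
have l1 := lower _ _ _ f_01 f01 f_cvg e0.
have l2 : \forall n \near \oo,
    expect p (fun x => 1 - f x) - e < expect (p_ n) (fun x => 1 - f_ n x).
  apply: (lower (fun n x => 1 - f_ n x)) => //.
  - by move=> n; exact: unit_valued_onem.
  - exact: unit_valued_onem.
  - by move=> x; apply: cvgB; [exact: cvg_cst|exact: f_cvg].
near=> n.
have : expect p f - e < expect (p_ n) (f_ n) by near: n.
have : expect p (fun x => 1 - f x) - e < expect (p_ n) (fun x => 1 - f_ n x).
  by near: n.
rewrite !expect_onem// ler_norml => h1 h2.
by apply/andP; split; lra.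
Unshelve. all: by end_near. Qed.

(** p (P f) = (p P) f by interchanging two nonnegative sums, and p P = p. *)
Lemma expect_stationary (P : S -> S -> R) p f : transition_matrix P ->
  stationary_distribution P p -> unit_valued f ->
  expect p (fun x => expect (P x) f) = expect p f.
Proof.
move=> tP [pp sP] f01; have p0 : forall x, 0 <= p x by case: pp.
have P0 x y : 0 <= P x y by case: (tP x).
have f0 x : 0 <= f x by case/andP: (f01 x).
apply: EFin_inj; rewrite !expectE//; last by move=> x; exact: expect_unit.
transitivity (\esum_(x in [set: S]) \esum_(y in [set: S])
    (p x * P x y * f y)%:E).
  apply: eq_esum => x _; rewrite EFinM expectE// -esumZl//.
    by apply: eq_esum => y _; rewrite -EFinM mulrA.
  by move=> y; exact: esum_term_ge0.
rewrite esum_interchange; last by move=> x y; rewrite lee_fin !mulr_ge0.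
apply: eq_esum => y _; rewrite EFinM -sP muleC -esumZl//; last first.
  by move=> x; rewrite lee_fin mulr_ge0.
by apply: eq_esum => x _; rewrite -EFinM mulrC.
Qed.

End expectation.

(** A positive entry of a power of [P] comes from a path of positive transitions starting at [z],
    along which [A] is handed on. The induction is on the length of the path, with [z] moving along
    its first edge. *)
Lemma irreducible_ind (R : realType) (S : countType) (P : S -> S -> R)
    (A : S -> Prop) (z : S) : irreducible P -> transition_matrix P ->
  (forall x y, A x -> 0 < P x y -> A y) -> A z -> forall y, A y.
Proof.
move=> irrP tP Astep Az y; have [m] := irrP z y.
elim: m z Az => [|m IH] z Az /=.
  by case: eqP => [<-//|_]; rewrite ltxx.
move=> sum_gt0.
have /existsNP[w /eqP w_neq0] :
    ~ forall w, ((P z w)%:E * matrix_power P m w y = 0)%E.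
  by move=> all0; move: sum_gt0; rewrite esum1// ltxx.
have mp_ge0 : (0 <= matrix_power P m w y)%E.
  elim: m w {IH sum_gt0 w_neq0} => [|m IHm] w /=; first by rewrite lee_fin.
  by apply: esum_ge0 => v _; rewrite mule_ge0 ?lee_fin//; case: (tP w).
move: w_neq0; rewrite mule_eq0 negb_or eqe => /andP[Pzw mw].
have Pzw0 : 0 < P z w by rewrite lt0r Pzw /=; case: (tP z).
by apply: (IH w); [exact: Astep Az Pzw0|rewrite lt0e mw].
Qed.

(** * The killed chain and its decay under a stationary distribution *)

Section discount.
Variables (R : realType) (S : countType).
Implicit Types (P : S -> S -> R) (k q f g pi : S -> R).

(** This is (diag(k) P)^j f; its value at x is the mean of k(X_0) ... k(X_(j-1)) f(X_j) for the
    chain started at x. *)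
Definition discount P k f (j : nat) : S -> R :=
  iter j (fun g x => k x * expect (P x) g) f.

Lemma discount_unit P k f j : transition_matrix P ->
  unit_valued k -> unit_valued f -> unit_valued (discount P k f j).
Proof.
move=> tP k01 f01; elim: j => // j IH x /=.
have /andP[k0 k1] := k01 x; have /andP[e0 e1] := expect_unit (tP x) IH.
by rewrite mulr_ge0//= mulr_ile1.
Qed.

Lemma le_discount P k q f g j x : transition_matrix P ->
  unit_valued k -> unit_valued q -> unit_valued f -> unit_valued g ->
  (forall x, k x <= q x) -> (forall x, f x <= g x) ->
  discount P k f j x <= discount P q g j x.
Proof.
move=> tP k01 q01 f01 g01 kq fg; elim: j x => [//|j IH] x.
have u1 := discount_unit j tP k01 f01; have u2 := discount_unit j tP q01 g01.
rewrite /= ler_pM//; first by case/andP: (k01 x).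
  by case/andP: (expect_unit (tP x) u1).
exact: le_expect.
Qed.

(** Only the successor [y] is kept in the average over one step. Smallness at [x] thus passes to [y]
    when [k x] and [P x y] are positive, with time moved by one. *)
Lemma discount_edge P k f j x y : transition_matrix P ->
  unit_valued k -> unit_valued f ->
  k x * P x y * discount P k f j y <= discount P k f j.+1 x.
Proof.
move=> tP k01 f01; rewrite -mulrA /= ler_wpM2l//; first by case/andP: (k01 x).
by apply: expect_ge => //; exact: discount_unit.
Qed.

Lemma cvg_discount (P_ : nat -> S -> S -> R) P k f j x :
  (forall n, transition_matrix (P_ n)) -> transition_matrix P ->
  (forall x y, P_ n x y @[n --> \oo] --> P x y) ->
  unit_valued k -> unit_valued f ->
  discount (P_ n) k f j x @[n --> \oo] --> discount P k f j x.
Proof.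
move=> tP_ tP P_cvg k01 f01; elim: j x => [|j IH] x; first exact: cvg_cst.
apply: cvgM; first exact: cvg_cst.
apply: cvg_expect => //; first by move=> n; exact: tP_.
  by move=> n; exact: discount_unit.
exact: discount_unit.
Qed.

Lemma discount0 P k j : discount P k (fun=> 0) j = fun=> 0.
Proof.
elim: j => //= j ->; apply/funext => x; rewrite /expect esum1 ?mulr0// => y _.
by rewrite mulr0.
Qed.

(** Some state carries mass because the total is 1, and stationarity passes mass along edges: pi y
    >= pi x P x y. *)
Lemma stationary_gt0 P pi x : irreducible P -> transition_matrix P ->
  stationary_distribution P pi -> 0 < pi x.
Proof.
move=> irrP tP [[pi0 pi1] piP].
have [z piz] : exists z, 0 < pi z.
  apply/not_existsP => npos; move: pi1; rewrite esum1.
    by move/eqP; rewrite eqe eq_sym oner_eq0.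
  move=> y _; congr EFin; apply/eqP; rewrite eq_le pi0 andbT leNgt.
  exact/negP/npos.
move: x; apply: (irreducible_ind (A := fun x => 0 < pi x) irrP tP _ piz).
move=> x y pix Pxy.
rewrite -lte_fin -piP.
have P0 u v : 0 <= P u v by case: (tP u).
apply: (@lt_le_trans _ _ (pi x * P x y)%:E); first by rewrite lte_fin mulr_gt0.
apply: (@esum_ge1 _ _ (fun x => (pi x * P x y)%:E)) => u.
by rewrite lee_fin mulr_ge0.
Qed.

(** Put f_j = (diag(q) P)^j f and e = P f_j, so that f_(j+1) = q e <= e. Since pi e = pi f_j by
    stationarity, it suffices to average a pointwise bound; at [z] the gap e - f_(j+1) = (1 - q) e
    has room for (1 - q) f_(j+1). *)
Lemma discount_drop P pi q f j z : transition_matrix P ->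
  stationary_distribution P pi -> unit_valued q -> unit_valued f ->
  expect pi (discount P q f j.+1) + pi z * ((1 - q z) * discount P q f j.+1 z)
  <= expect pi (discount P q f j).
Proof.
move=> tP sP q01 f01; have [pp _] := sP.
have u := discount_unit j tP q01 f01.
have u' := discount_unit j.+1 tP q01 f01.
have /andP[c0 c1] : 0 <= (1 - q z) * discount P q f j.+1 z <= 1.
  have /andP[qz0 qz1] := q01 z; have /andP[dz0 dz1] := u' z.
  by rewrite mulr_ge0 ?subr_ge0//= mulr_ile1 ?subr_ge0// lerBlDr lerDl.
have drop x : discount P q f j.+1 x +
    (if x == z then (1 - q z) * discount P q f j.+1 z else 0) <=
    expect (P x) (discount P q f j).
  have /andP[qx0 qx1] := q01 x.
  have /andP[ex0 ex1] := expect_unit (tP x) u.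
  case: eqP => [<-|_] /=; last by rewrite addr0 ler_piMl.
  set e := expect _ _ in ex0 ex1 *; rewrite -subr_ge0.
  (* The difference at [z] is e - q e - (1 - q) q e. *)
  rewrite (_ : _ - _ = (1 - q x) ^+ 2 * e); last by ring.
  by rewrite mulr_ge0// sqr_ge0.
have Pd01 x : 0 <= expect (P x) (discount P q f j) <= 1.
  exact: expect_unit.
have pt01 : unit_valued (fun x =>
    if x == z then (1 - q z) * discount P q f j.+1 z else 0).
  by move=> x; case: eqP => _; rewrite ?c0 ?c1 ?lexx ?ler01.
have sum01 : unit_valued (fun x => discount P q f j.+1 x +
    (if x == z then (1 - q z) * discount P q f j.+1 z else 0)).
  move=> x; rewrite addr_ge0/=; [|by case/andP: (u' x)|by case/andP: (pt01 x)].
  by rewrite (le_trans (drop x))//; case/andP: (Pd01 x).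
rewrite -(expect_point z pp) ?c0 ?c1// -expectD// -(expect_stationary tP sP u).
exact: le_expect.
Qed.

(** Telescoping [discount_drop]: the losses at [z] after time [J] are paid out of the average
    available at time [J], however many are counted. *)
Lemma discount_tail P pi q f J m z : transition_matrix P ->
  stationary_distribution P pi -> unit_valued q -> unit_valued f ->
  pi z * (1 - q z) * \sum_(i < m) discount P q f (J.+1 + i)%N z <=
  expect pi (discount P q f J).
Proof.
move=> tP sP q01 f01; have [pp _] := sP.
(* The average left at time J + m is kept so that the induction closes; being nonnegative, it is
   then discarded. *)
suff : pi z * (1 - q z) * \sum_(i < m) discount P q f (J.+1 + i)%N z +
    expect pi (discount P q f (J + m)) <= expect pi (discount P q f J).
  apply: le_trans; rewrite lerDl.
  by case/andP: (expect_unit pp (discount_unit (J + m) tP q01 f01)).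
elim: m => [|m IH]; first by rewrite big_ord0 mulr0 add0r addn0.
apply: le_trans IH; rewrite big_ord_recr /= mulrDr -addrA lerD2l addnS.
by rewrite addrC -mulrA; exact: discount_drop.
Qed.

(** Positivity of [k] allows division in [discount_edge], so the limit 0 spreads along every edge by
    squeezing. *)
Lemma discount_vanish P k f z : irreducible P -> transition_matrix P ->
  unit_valued k -> (forall x, 0 < k x) -> unit_valued f ->
  discount P k f j z @[j --> \oo] --> 0 ->
  forall y, discount P k f j y @[j --> \oo] --> 0.
Proof.
move=> irrP tP k01 k0 f01.
apply: (irreducible_ind (A := fun y => discount P k f j y @[j --> \oo] --> 0)
  irrP tP) => x y x0 Pxy.
have c0 : 0 < k x * P x y by rewrite mulr_gt0.
apply: (@squeeze_cvgr _ _ _ _ (fun=> 0)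
    (fun j => (k x * P x y)^-1 * discount P k f j.+1 x)).
- apply: nearW => j.
  have /andP[-> _] /= := discount_unit j tP k01 f01 y.
  by rewrite mulrC ler_pdivlMr// mulrC discount_edge.
- exact: cvg_cst.
- rewrite -[X in _ --> X](mulr0 (k x * P x y)^-1); apply: cvgM.
    exact: cvg_cst.
  by move: x0; rewrite -cvg_shiftS.
Qed.

(** Dominated convergence, as the case of [cvg_expect] with a constant sequence of vectors. *)
Lemma cvg_expect_discount0 P pi k f : transition_matrix P ->
  probability_vector pi -> unit_valued k -> unit_valued f ->
  (forall y, discount P k f j y @[j --> \oo] --> 0) ->
  expect pi (discount P k f j) @[j --> \oo] --> 0.
Proof.
move=> tP pp k01 f01 d0.
have -> : 0 = expect pi (fun=> 0).
  by rewrite /expect esum1// => x _; rewrite mulr0.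
apply: (@cvg_expect _ _ (fun=> pi)) => // [j|x|x].
- exact: discount_unit.
- by rewrite lexx ler01.
- exact: cvg_cst.
Qed.

End discount.

(** * Uniformly small tails and limits of series *)

Section uniform_tail.
Variable R : realType.
Implicit Types (a b : nat -> nat -> R).

(** Tails are measured by finite stretches of arbitrary length, so that no convergence of the rows
    is presupposed. *)
Definition uniform_tail b : Prop := forall e, 0 < e ->
  exists J, \forall n \near \oo, forall m, \sum_(i < m) b n (J + i)%N <= e.

Lemma uniform_tail_le a b : (forall n j, a n j <= b n j) ->
  uniform_tail b -> uniform_tail a.
Proof.
move=> ab tb e /tb[J Jb]; exists J; apply: filterS Jb => n nb m.
by apply: le_trans (nb m); apply: ler_sum => i _.
Qed.

Lemma uniform_tail_edge a b (c_ : nat -> R) (c : R) :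
  (forall n j, 0 <= a n j) -> (forall n j, 0 <= b n j) ->
  c_ n @[n --> \oo] --> c -> 0 < c ->
  (forall n j, c_ n * a n j <= b n j.+1) ->
  uniform_tail b -> uniform_tail a.
Proof.
move=> a0 b0 c_cvg c0 ab tb e e0.
(* Eventually [c_ n] is at least c / 2, and dividing by c / 2 leaves [e]. The time shift is absorbed
   below by taking m.+1 terms of [b]. *)
have [|J Jb] := tb (c / 2 * e); first by rewrite mulr_gt0// divr_gt0.
exists J; near=> n => m.
have cn : c / 2 <= c_ n.
  near: n; apply: (cvgr_ge c) => //; first by lra.
have c20 : 0 < c / 2 by rewrite divr_gt0.
rewrite -(ler_pM2l c20).
have nb : forall m, \sum_(i < m) b n (J + i)%N <= c / 2 * e by near: n.
apply: le_trans (nb m.+1); rewrite big_ord_recl /= -[leLHS]add0r lerD//.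
rewrite mulr_sumr; apply: ler_sum => i _.
by rewrite addnS; apply: le_trans (ab n _); exact: ler_wpM2r.
Unshelve. all: by end_near. Qed.

(** The lower bound is Fatou's inequality and settles an infinite limit. For a finite limit the
    series is cut at J: the head converges and the tail is uniformly small. The tail condition is
    conditional on finiteness because, for a chain without killing, it is derived from it. *)
Lemma cvg_nneseries_uniform_tail a (a' : nat -> R) :
  (forall n j, 0 <= a n j) -> (forall j, 0 <= a' j) ->
  (forall j, a n j @[n --> \oo] --> a' j) ->
  ((\sum_(0 <= j <oo) (a' j)%:E < +oo)%E -> uniform_tail a) ->
  (\sum_(0 <= j <oo) (a n j)%:E)%E @[n --> \oo] -->
  (\sum_(0 <= j <oo) (a' j)%:E)%E.
Proof.
move=> a0 a'0 a_cvg tail.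
have lower (c : \bar R) : (c < \sum_(0 <= j <oo) (a' j)%:E)%E ->
    \forall n \near \oo, (c < \sum_(0 <= j <oo) (a n j)%:E)%E.
  rewrite nneseries_esumT// => clt.
  apply: filterS (lt_esum_near a_cvg clt) => n.
  by rewrite nneseries_esumT// => j; exact: a0.
have [|] := ltP (\sum_(0 <= j <oo) (a' j)%:E)%E +oo%E; last first.
  rewrite leye_eq => /eqP eoo; rewrite eoo in lower *.
  by apply/cvgeyPgt => A; apply: lower; rewrite ltry.
move=> fin; have {}tail := tail fin.
have s0 : (0 <= \sum_(0 <= j <oo) (a' j)%:E)%E.
  by apply: nneseries_ge0 => j _ _; rewrite lee_fin.
have := fin; rewrite -ge0_fin_numE// => /fineK.
set l := fine _ => El; rewrite -El.
have upper e : 0 < e -> \forall n \near \oo,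
    (\sum_(0 <= j <oo) (a n j)%:E <= (l + e)%:E)%E.
  move=> e0; have e20 : 0 < e / 2 by rewrite divr_gt0.
  have [J Jb] := tail _ e20.
  have head : \sum_(i < J) a n i @[n --> \oo] --> \sum_(i < J) a' i.
    by apply: cvg_big => [|i _]; [exact: add_continuous|exact: a_cvg].
  have headl : \sum_(i < J) a' i <= l.
    rewrite -lee_fin El -sumEFin -(big_mkord xpredT (fun i => (a' i)%:E)).
    by apply: nneseries_lim_ge => i _ _; rewrite lee_fin.
  near=> n.
  have h1 : \sum_(i < J) a n i <= l + e / 2.
    near: n; apply: (cvgr_le _ head); lra.
  have h2 : forall m, \sum_(i < m) a n (J + i)%N <= e / 2 by near: n.
  apply: lime_le; first by apply: is_cvg_nneseries => j _ _; rewrite lee_fin.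
  apply: nearW => N; rewrite sumEFin lee_fin.
  (* Lengthening to J + N terms guarantees that the cut at J lies inside the range. *)
  apply: (@le_trans _ _ (\sum_(0 <= i < J + N) a n i)).
    by rewrite [leRHS](big_cat_nat (n := N)) ?leq_addl//= lerDl sumr_ge0.
  rewrite (big_cat_nat (n := J)) ?leq_addr//= big_mkord.
  have -> : \sum_(J <= i < J + N) a n i = \sum_(i < N) a n (J + i)%N.
    have := big_addn 0 (J + N) J xpredT (a n).
    rewrite add0n addKn => ->; rewrite big_mkord.
    by apply: eq_bigr => i _; rewrite addnC.
  by rewrite [l + e](_ : _ = l + e / 2 + e / 2); [exact: lerD|lra].
apply: cvg_EFin.
  (* The value 1 is arbitrary: the bound only ensures that the series are eventually finite. *)
  have := upper 1 ltr01; apply: filterS => n un.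
  rewrite ge0_fin_numE; first by rewrite (le_lt_trans un)// ltry.
  by apply: nneseries_ge0 => j _ _; rewrite lee_fin.
apply/cvgrPdist_le => e e0; near=> n.
have hu : (\sum_(0 <= j <oo) (a n j)%:E <= (l + e)%:E)%E.
  by near: n; exact: upper.
have hl : ((l - e)%:E < \sum_(0 <= j <oo) (a n j)%:E)%E.
  by near: n; apply: lower; rewrite -El lte_fin ltrBlDr ltrDl.
have fn : (\sum_(0 <= j <oo) (a n j)%:E)%E \is a fin_num.
  rewrite ge0_fin_numE; first by rewrite (le_lt_trans hu)// ltry.
  by apply: nneseries_ge0 => j _ _; rewrite lee_fin.
move: hu hl; rewrite -(fineK fn) lee_fin lte_fin /= ler_norml => hu hl.
by apply/andP; split; lra.
Unshelve. all: by end_near. Qed.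

End uniform_tail.

(** * Convergence of the discounted series along the chains *)

Section limit.
Variables (R : realType) (S : countType).
Variables (P_ : nat -> S -> S -> R) (P : S -> S -> R).
Variables (pi_ : nat -> S -> R) (pi : S -> R).
Hypothesis tP_ : forall n, transition_matrix (P_ n).
Hypothesis tP : transition_matrix P.
Hypothesis sP_ : forall n, stationary_distribution (P_ n) (pi_ n).
Hypothesis sP : stationary_distribution P pi.
Hypothesis irrP : irreducible P.
Hypothesis P_cvg : forall x y, P_ n x y @[n --> \oo] --> P x y.
Hypothesis pi_cvg : forall x, pi_ n x @[n --> \oo] --> pi x.

(** The partial sums at [z] are bounded by [discount_tail], so the series there converges and its
    terms vanish; [discount_vanish] reaches the other states. *)
Lemma discount_cvg0 (q : S -> R) (f : S -> R) z y : unit_valued q ->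
  unit_valued f -> (forall x, 0 < q x) -> q z < 1 ->
  discount P q f j y @[j --> \oo] --> 0.
Proof.
move=> q01 f01 q0 qz1; apply: (discount_vanish (z := z)) => //.
have piz : 0 < pi z * (1 - q z).
  by rewrite mulr_gt0 ?subr_gt0//; exact: stationary_gt0 sP.
(* [discount_tail] with J = 0 controls times from 1 on, hence the shift. *)
rewrite -cvg_shiftS; apply: cvg_series_cvg_0.
apply: nondecreasing_is_cvgn.
  apply/nondecreasing_seqP => n; rewrite /series /= big_nat_recr//= lerDl.
  by case/andP: (discount_unit n.+1 tP q01 f01 z).
exists (pi z * (1 - q z))^-1 => _ [m _ <-].
rewrite -[leRHS]mul1r ler_pdivlMr// mulrC /series /= big_mkord.
apply: (le_trans (discount_tail 0 m z tP sP q01 f01)).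
by case: sP => pp _; case/andP: (expect_unit pp f01).
Qed.

Lemma uniform_tail_discount (q : S -> R) (f : S -> R) z y : unit_valued q ->
  unit_valued f -> (forall x, 0 < q x) -> q z < 1 ->
  uniform_tail (fun n j => discount (P_ n) q f j y).
Proof.
move=> q01 f01 q0 qz1; have [pp _] := sP.
have d0 n j x : 0 <= discount (P_ n) q f j x.
  by case/andP: (discount_unit j (tP_ n) q01 f01 x).
move: y; apply: (irreducible_ind
  (A := fun y => uniform_tail (fun n j => discount (P_ n) q f j y))
  (z := z) irrP tP) => [x y utx Pxy|e e0].
- apply: (uniform_tail_edge (c_ := fun n => q x * P_ n x y) (c := q x * P x y)
    _ _ _ _ _ utx) => //.
  + by apply: cvgM; [exact: cvg_cst|exact: P_cvg].
  + by rewrite mulr_gt0.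
  + by move=> n j; exact: discount_edge.
have piz : 0 < pi z * (1 - q z).
  by rewrite mulr_gt0 ?subr_gt0//; exact: stationary_gt0 sP.
set c := pi z * (1 - q z) in piz.
(* Eventually pi_n(z) (1 - q(z)) >= c / 2, so a tail bound c / 2 * e before division yields [e]. The
   time [J] is chosen from the limit chain alone, before [n]. *)
have ec0 : 0 < c / 2 * e by rewrite mulr_gt0// divr_gt0.
have [J EJ] : exists J, expect pi (discount P q f J) < c / 2 * e.
  have := cvg_expect_discount0 tP pp q01 f01
    (fun y => discount_cvg0 y q01 f01 q0 qz1).
  move=> /cvgr_lt/(_ _ ec0)[J _ EJ]; exists J.
  by apply: EJ; rewrite /= leqnn.
exists J.+1; near=> n => m.
have cn : c / 2 <= pi_ n z * (1 - q z).
  near: n; apply: (cvgr_ge c); last by lra.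
  by apply: cvgM; [exact: pi_cvg|exact: cvg_cst].
have En : expect (pi_ n) (discount (P_ n) q f J) <= c / 2 * e.
  near: n; apply: (cvgr_le (expect pi (discount P q f J))) => //.
  apply: cvg_expect => //.
  - by move=> n; case: (sP_ n).
  - by move=> n; exact: discount_unit.
  - exact: discount_unit.
  - by move=> x; exact: cvg_discount.
have c20 : 0 < c / 2 by rewrite divr_gt0.
rewrite -(ler_pM2l c20); apply: le_trans En.
apply: le_trans (discount_tail J m z (tP_ n) (sP_ n) q01 f01).
by apply: ler_wpM2r => //; exact: sumr_ge0.
Unshelve. all: by end_near. Qed.

Lemma cvg_discount_series (k r : S -> R) x : unit_valued k -> unit_valued r ->
  (\sum_(0 <= j <oo) (discount (P_ n) k r j x)%:E)%E @[n --> \oo] -->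
  (\sum_(0 <= j <oo) (discount P k r j x)%:E)%E.
Proof.
move=> k01 r01; have [pp _] := sP.
have d0 y j : 0 <= discount P k r j y.
  by case/andP: (discount_unit j tP k01 r01 y).
apply: cvg_nneseries_uniform_tail => //.
- by move=> n j; case/andP: (discount_unit j (tP_ n) k01 r01 x).
- by move=> j; exact: cvg_discount.
move=> sum_fin.
have one01 : @unit_valued R S (fun=> 1) by move=> y; rewrite ler01 lexx.
have [[z kz]|] := pselect (exists z, k z < 1).
  (* The floor 1/2 keeps [q] positive where [k] vanishes, as propagation along edges requires, and
     leaves q(z) < 1. The tails for [k] and [r] lie below those for [q] and 1. *)
  pose q y := Num.max (k y) (2^-1).
  have q01 : unit_valued q.
    move=> y; have /andP[ky0 ky1] := k01 y.
    by rewrite /q le_max ky0/= ge_max ky1/=; lra.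
  apply: (@uniform_tail_le _ _ (fun n j => discount (P_ n) q (fun=> 1) j x)).
    move=> n j; apply: le_discount => // y; first by rewrite /q le_max lexx.
    by case/andP: (r01 y).
  apply: (uniform_tail_discount (z := z)) => //.
    by move=> y; rewrite /q lt_max invr_gt0 ltr0n orbT.
  by rewrite /q gt_max kz/=; lra.
move=> /forallNP k_ge1.
have k1 y : k y = 1.
  apply/eqP; rewrite eq_le; have /andP[_ ->] /= := k01 y.
  by rewrite leNgt; exact/negP/k_ge1.
have dx0 : discount P k r j x @[j --> \oo] --> 0.
  exact/cvg_series_cvg_0/nnseries_is_cvg.
(* Without killing, stationarity keeps pi (P^j r) constant in j, while [dx0], spread to all states,
   makes it tend to 0. *)
have pr0 : expect pi r = 0.
  have pr j : expect pi (discount P k r j) = expect pi r.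
    elim: j => // j <-; rewrite -[RHS](expect_stationary tP sP); last first.
      exact: discount_unit.
    by congr expect; apply/funext => y; rewrite /= k1 mul1r.
  have : expect pi (discount P k r j) @[j --> \oo] --> 0.
    apply: cvg_expect_discount0 => //; apply: discount_vanish dx0 => // y.
    by rewrite k1.
  under eq_fun do rewrite pr.
  by move=> /(cvg_lim (@norm_hausdorff _ _)); rewrite lim_cst.
have r0 : r = fun=> 0.
  apply/funext => y; apply/eqP; rewrite eq_le.
  have /andP[-> _] := r01 y; rewrite andbT.
  rewrite -(pmulr_rle0 _ (stationary_gt0 y irrP tP sP)).
  by have := expect_ge y pp r01; rewrite pr0.
move=> e e0; exists 0%N; apply: nearW => n m.
by rewrite r0 big1 ?ltW// => i _; rewrite discount0.
Qed.

End limit.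

(** * Integrals of functions of a countable-valued random variable *)

Section countable_valued.
Variables (R : realType) (d : measure_display) (Omega : measurableType d).
Variables (Pr : probability Omega R) (T : countType) (Y : Omega -> T).
Hypothesis mY : forall t, measurable (Y @^-1` [set t]).

Lemma measurable_fun_countable (h : T -> \bar R) :
  measurable_fun setT (h \o Y).
Proof.
move=> _ B mB; rewrite setTI.
rewrite (_ : _ @^-1` _ = \bigcup_(t in [set: T])
    (if `[< B (h t) >] then Y @^-1` [set t] else set0)).
  apply: countable_bigcupT_measurable => [|t]; first exact: countableP.
  by case: ifP.
apply/seteqP; split => [w /= Bw|w [t _]].
  by exists (Y w) => //; rewrite asboolT.
by case: asboolP => //= Bt Yt; rewrite Yt.
Qed.

Lemma integral_countable (h : T -> \bar R) : (forall t, 0 <= h t)%E ->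
  (\int[Pr]_w h (Y w) = \esum_(t in [set: T]) (h t * Pr (Y @^-1` [set t])))%E.
Proof.
move=> h0.
(* The fibres of [Y], enumerated by [pickle], partition the space; codes of no element get the empty
   set. *)
pose F n : set Omega :=
  if pickle_inv n is Some t then Y @^-1` [set t] else set0 : set Omega.
have FP n w : F n w -> n = pickle (Y w).
  rewrite /F; have := pickle_invK (T := T) n.
  by case: pickle_inv => //= t <- ->.
have FE : \bigcup_n F n = setT.
  apply/seteqP; split => // w _; exists (pickle (Y w)) => //.
  by rewrite /F pickleK_inv.
rewrite -FE ge0_integral_bigcup//=; last 3 first.
- by move=> n; rewrite /F; case: pickle_inv.
- by rewrite FE; exact: measurable_fun_countable.
- apply/trivIsetP => i j _ _ /eqP ij; apply/seteqP; split => // w [iw jw].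
  by apply: ij; rewrite (FP _ _ iw) (FP _ _ jw).
pose G n := if pickle_inv n is Some t then
  (h t * Pr (Y @^-1` [set t]))%E else 0%E.
rewrite (eq_eseriesr (g := G)); last first.
  move=> n _; rewrite /F /G; case: pickle_inv => [t|]; last first.
    by rewrite integral_set0.
  rewrite -integral_cst//; apply: eq_integral => w.
  by rewrite inE /= => ->.
have G0 n : (0 <= G n)%E.
  by rewrite /G; case: pickle_inv => // t; rewrite mule_ge0.
rewrite nneseries_esumT//.
transitivity (\esum_(n in range (@pickle T)) G n).
  rewrite [RHS]esum_mkcond; apply: eq_esum => n _; case: ifPn => //.
  rewrite notin_setE /G; have := @pickle_invK T n.
  by case: pickle_inv => //= t <- []; exists t.
rewrite (@reindex_esum _ _ _ [set: T] _ (@pickle T)).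
  by apply: eq_esum => t _; rewrite /G pickleK_inv.
split => // t u _ _; exact: (pcan_inj pickleK).
Qed.

End countable_valued.

(** * The expected reward as the series of the killed chain *)

Section markov_chain.
Variables (R : realType) (S : countType).
Variables (d : measure_display) (Omega : measurableType d).
Variables (Pr : probability Omega R) (X : nat -> Omega -> S) (x : S).
Variable (P : S -> S -> R).
Hypothesis tP : transition_matrix P.
Hypothesis mcX : markov_chain Pr X x P.

Let measurable_path_event m s : measurable (path_event X m s).
Proof.
have [mX _ _] := mcX.
rewrite (_ : path_event X m s =
    \bigcap_(i in [set i | (i <= m)%N]) X i @^-1` [set s i]).
  by apply: bigcap_measurableType => i _.
by apply/seteqP; split.
Qed.

(** The product form of the Markov property also covers null paths, where both sides are 0. *)
Let markov_chain_path m s :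
  Pr (X m.+1 @^-1` [set s m.+1] `&` path_event X m s) =
  ((P (s m) (s m.+1))%:E * Pr (path_event X m s))%E.
Proof.
have [mX _ mkv] := mcX; have mp := measurable_path_event m s.
have [p0|] := boolP (0 < Pr (path_event X m s))%E; last first.
  rewrite -leNgt => p0; have {}p0 : Pr (path_event X m s) = 0%E.
    by apply/eqP; rewrite eq_le p0 measure_ge0.
  rewrite p0 mule0; apply/eqP; rewrite eq_le measure_ge0 andbT -p0.
  by apply: le_measure; rewrite ?inE//; exact: measurableI.
rewrite -mkv// -[X in (_ * X)%E]fineK ?fin_num_measure// -EFinM divfK.
  by rewrite fineK// fin_num_measure//; exact: measurableI.
by rewrite gt_eqF// fine_gt0// p0/= -ge0_fin_numE// fin_num_measure.
Qed.

(** The history up to time [m] is a single variable with values in the countable type of lists, to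
    which [integral_countable] applies. *)
Let path m w := mkseq (X^~ w) m.+1.

Let path_fiber m (t : seq S) : path m @^-1` [set t] =
  if size t == m.+1 then path_event X m (nth x t) else set0.
Proof.
case: eqP => [tm|tm]; apply/seteqP; split => // w; rewrite /path /=.
- by move=> <- i im; rewrite nth_mkseq.
- move=> pw; apply: (@eq_from_nth _ x); rewrite size_mkseq ?tm// => i im.
  by rewrite nth_mkseq// pw.
- by move=> tE; apply: tm; rewrite -tE size_mkseq.
Qed.

Let measurable_path m t : measurable (path m @^-1` [set t]).
Proof.
by rewrite path_fiber; case: ifP => // _; exact: measurable_path_event.
Qed.

Let measurable_path_next m (ty : seq S * S) :
  measurable ((fun w => (path m w, X m.+1 w)) @^-1` [set ty]).
Proof.
case: ty => t y; have [mX _ _] := mcX.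
rewrite (_ : _ @^-1` _ = path m @^-1` [set t] `&` X m.+1 @^-1` [set y]).
  exact: measurableI.
by apply/seteqP; split => w /= [-> ->].
Qed.

Let prob_path_next m t y :
  Pr ((fun w => (path m w, X m.+1 w)) @^-1` [set (t, y)]) =
  ((P (nth x t m) y)%:E * Pr (path m @^-1` [set t]))%E.
Proof.
rewrite (_ : _ @^-1` _ = X m.+1 @^-1` [set y] `&` path m @^-1` [set t]);
  last by apply/seteqP; split => w /= [-> ->].
rewrite path_fiber; case: ifP => _; last by rewrite setI0 measure0 mule0.
(* One sequence must carry both the past and the next state: [s] follows [t] up to time [m] and
   equals [y] afterwards. *)
pose s i := if (i <= m)%N then nth x t i else y.
have -> : path_event X m (nth x t) = path_event X m s.
  apply/seteqP; split => w pw i im; rewrite pw// /s im//.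
have -> : y = s m.+1 by rewrite /s ltnn.
have -> : nth x t m = s m by rewrite /s leqnn.
exact: markov_chain_path.
Qed.

Let weight (k : S -> R) m (t : seq S) := \prod_(0 <= i < m) k (nth x t i).

Let weight_path k m n w : (n <= m.+1)%N ->
  weight k n (path m w) = \prod_(0 <= i < n) k (X i w).
Proof.
move=> nm; apply: eq_big_nat => i /andP[_ /leq_trans/(_ nm) im].
by rewrite nth_mkseq.
Qed.

Let reward k g j w : \bar R := (\prod_(0 <= i < j) k (X i w) * g (X j w))%:E.

Let measurable_reward k g j : measurable_fun setT (reward k g j).
Proof.
rewrite (_ : reward _ _ _ =
    (fun t => (weight k j t * g (nth x t j))%:E) \o path j).
  exact: (measurable_fun_countable (measurable_path j)).
by apply/funext => w /=; rewrite weight_path// nth_mkseq.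
Qed.

(** Conditioning on the history up to time j replaces g(X_(j+1)) by (P g)(X_j), and the last factor
    k(X_j) joins the terminal function. *)
Let integral_rewardS k g j : unit_valued k -> unit_valued g ->
  (\int[Pr]_w reward k g j.+1 w =
   \int[Pr]_w reward k (fun y => k y * expect (P y) g)%R j w)%E.
Proof.
move=> k01 g01.
have w0 n t : 0 <= weight k n t.
  by apply: prodr_ge0 => i _; case/andP: (k01 (nth x t i)).
have g0 y : 0 <= g y by case/andP: (g01 y).
have e0 y : 0 <= expect (P y) g by case/andP: (expect_unit (tP y) g01).
have P0 y z : 0 <= P y z by case: (tP y).
pose h (ty : seq S * S) := (weight k j.+1 ty.1 * g ty.2)%:E.
pose h' (t : seq S) := (weight k j.+1 t * expect (P (nth x t j)) g)%:E.
transitivity (\int[Pr]_w h (path j w, X j.+1 w))%E.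
  by apply: eq_integral => w _; rewrite /h /= weight_path.
transitivity (\int[Pr]_w h' (path j w))%E; last first.
  apply: eq_integral => w _; rewrite /h' weight_path// nth_mkseq// /reward.
  by rewrite big_nat_recr//= mulrA.
rewrite (integral_countable Pr (measurable_path_next j)); last first.
  by move=> ty; rewrite lee_fin mulr_ge0.
rewrite (integral_countable Pr (measurable_path j)); last first.
  by move=> t; rewrite lee_fin mulr_ge0.
transitivity (\esum_(ty in [set: seq S] `*`` (fun=> [set: S]))
    ((weight k j.+1 ty.1 * g ty.2)%:E *
     ((P (nth x ty.1 j) ty.2)%:E * Pr (path j @^-1` [set ty.1])))%E).
  have -> : [set: seq S] `*`` (fun=> [set: S]) = setT by apply/seteqP; split.
  by apply: eq_esum => -[t y] _; rewrite prob_path_next.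
rewrite -(@esum_esum R _ _ [set: seq S] (fun=> [set: S]) (fun t y =>
    ((weight k j.+1 t * g y)%:E *
     ((P (nth x t j) y)%:E * Pr (path j @^-1` [set t])))%E)); last first.
  by move=> t y _ _; rewrite !mule_ge0// lee_fin// mulr_ge0.
apply: eq_esum => t _; rewrite /h' EFinM expectE//.
have pfin : Pr (path j @^-1` [set t]) \is a fin_num by exact: fin_num_measure.
rewrite -muleA -(fineK pfin) [X in (_ * X)%E]muleC -esumZl//; last first.
- by move=> y; rewrite lee_fin mulr_ge0.
- by rewrite fine_ge0.
rewrite -esumZl//; last first.
  by move=> y; rewrite mule_ge0// lee_fin ?mulr_ge0 ?fine_ge0.
apply: eq_esum => y _; rewrite -!EFinM; congr EFin; ring.
Qed.

Let integral_reward k g j : unit_valued k -> unit_valued g ->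
  (\int[Pr]_w reward k g j w = (discount P k g j x)%:E)%E.
Proof.
move=> k01; elim: j g => [|j IH] g g01.
  have [mX X0 _] := mcX.
  transitivity (\int[Pr]_w (g (X 0%N w))%:E)%E.
    by apply: eq_integral => w _; rewrite /reward big_geq// mul1r.
  have g0 y : (0 <= (g y)%:E)%E by rewrite lee_fin; case/andP: (g01 y).
  rewrite (integral_countable (Y := X 0%N) Pr _ g0)//.
  rewrite (esum_single (t := x)); first by rewrite X0 mule1.
    by rewrite X0 mule1.
  (* For y other than x, the event X_0 = y lies in the complement of an event of probability 1. *)
  move=> y yx; rewrite (_ : Pr _ = 0%E) ?mule0//.
  apply/eqP; rewrite eq_le measure_ge0 andbT.
  rewrite -[leRHS](subee (x := 1%E))// -[X in (_ <= _ - X)%E]X0.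
  rewrite -probability_setC//; apply: le_measure; rewrite ?inE//.
    exact: measurableC.
  by move=> w /= -> ; exact/eqP.
rewrite integral_rewardS// IH; first by rewrite /discount iterSr.
move=> y; have /andP[k0 k1] := k01 y.
by have /andP[e0 e1] := expect_unit (tP y) g01; rewrite mulr_ge0//= mulr_ile1.
Qed.

(** The condition j <= T says that X_0, ..., X_(j-1) all lie in [C]. It merges with the exponential
    into a product of k(X_i), with k = 0 off [C], and the sum then leaves the integral by monotone
    convergence. *)
Lemma expected_reward_series (C : set S) (alpha r : S -> R) :
  (forall y, 0 <= alpha y) -> unit_valued r ->
  expected_reward Pr X C alpha r =
  (\sum_(0 <= j <oo) (discount P
     (fun y => if y \in C then expR (- alpha y) else 0) r j x)%:E)%E.
Proof.
move=> alpha0 r01; set k := (fun y : S => _).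
have k01 : unit_valued k.
  move=> y; rewrite /k; case: ifP => _; last by rewrite lexx ler01.
  by rewrite expR_ge0 -expR0 ler_expR oppr_le0 alpha0.
transitivity (\int[Pr]_w \sum_(0 <= j <oo) reward k r j w)%E; last first.
  rewrite integral_nneseries; [|exact: measurableT| |]; last 2 first.
  - by move=> j; exact: (measurable_reward k r j).
  - move=> j w _; rewrite lee_fin mulr_ge0//; last by case/andP: (r01 (X j w)).
    by apply: prodr_ge0 => i _; case/andP: (k01 (X i w)).
  by apply: eq_eseriesr => j _; exact: integral_reward.
apply: eq_integral => w _; rewrite /discounted_reward eseries_mkcond.
apply: eq_eseriesr => j _.
have -> : (j%:R%:E <= exit_time R X C w)%E =
    [forall i : 'I_j, X i w \in C].
  apply/idP/forallP => [jT i|Cw].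
    apply: contraT; rewrite notin_setE => nC.
    move: jT; rewrite leNgt => /negP[].
    apply: (@le_lt_trans _ _ i%:R%:E); last by rewrite lte_fin ltr_nat.
    by apply: ereal_inf_lbound; exists (nat_of_ord i).
  apply: le_ereal_inf_tmp => _ [i /= nC <-]; rewrite lee_fin ler_nat leqNgt.
  by apply/negP => ij; apply: nC; have := Cw (Ordinal ij); rewrite inE.
rewrite /reward big_mkord; case: ifPn => [/forallP Cw|].
  rewrite big_mkord -sumrN expR_sum; congr (_ * _)%:E.
  by apply: eq_bigr => i _; rewrite /k Cw.
rewrite negb_forall => /existsP[i nC].
by rewrite (bigD1 i)//= /k (negbTE nC) !mul0r.
Qed.

End markov_chain.

(** * From the series of the killed chains back to expected rewards *)

Theorem theorem2 (R : realType) (S : countType) (C : set S) (alpha r : S -> R)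
    (P : nat -> S -> S -> R) (Pinf : S -> S -> R)
    (pi : nat -> S -> R) (piinf : S -> R)
    (d : measure_display) (Omega : measurableType d) (X : nat -> Omega -> S)
    (Pr : nat -> S -> probability Omega R) (Prinf : S -> probability Omega R) :
  C !=set0 ->
  (forall x, 0 <= alpha x) ->
  (forall x, 0 <= r x) -> (forall x, r x <= 1) ->
  (forall n, (1 <= n)%N -> transition_matrix (P n)) ->
  transition_matrix Pinf ->
  (forall n, (1 <= n)%N -> unique_stationary_distribution (P n) (pi n)) ->
  unique_stationary_distribution Pinf piinf ->
  irreducible Pinf ->
  (forall n x, (1 <= n)%N -> markov_chain (Pr n x) X x (P n)) ->
  (forall x, markov_chain (Prinf x) X x Pinf) ->
  (forall x y, (fun n => P n x y) @ \oo --> Pinf x y) ->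
  (forall x, (fun n => pi n x) @ \oo --> piinf x) ->
  forall x, (fun n => expected_reward (Pr n x) X C alpha r) @ \oo -->
            expected_reward (Prinf x) X C alpha r.
Proof.
move=> _ alpha0 r0 r1 tP tPinf sP [sPinf _] irrP mc mcinf P_cvg pi_cvg x.
have r01 : unit_valued r by move=> y; rewrite r0 r1.
(* The assumptions concern n >= 1, so the limit is taken along n.+1. *)
rewrite (expected_reward_series tPinf (mcinf x) C alpha0 r01) -cvg_shiftS.
pose k y : R := if y \in C then expR (- alpha y) else 0.
have k01 : unit_valued k.
  move=> y; rewrite /k; case: ifP => _; last by rewrite lexx ler01.
  by rewrite expR_ge0 -expR0 ler_expR oppr_le0 alpha0.
rewrite (_ : [sequence _]_n = fun n =>
    (\sum_(0 <= j <oo) (discount (P n.+1) k r j x)%:E)%E); last first.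
  apply/funext => n; rewrite /=.
  exact: (expected_reward_series (tP n.+1 isT) (mc n.+1 x isT) C alpha0 r01).
apply: (cvg_discount_series (pi_ := fun n => pi n.+1) (pi := piinf)) => //.
- by move=> n; exact: tP.
- by move=> n; have [] := sP n.+1 isT.
- by move=> y z; have := P_cvg y z; rewrite -cvg_shiftS.
- by move=> y; have := pi_cvg y; rewrite -cvg_shiftS.
Qed.
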